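(* Let $k\ge1$. For $1\le s\le k$ and $m\ge j\ge1$, \[ GL_k(k(m-1)+s,j)+GL_k(k(m-1)+s,\overline{j})=(z^{j-1}+z^j)q^{k\binom{j}{2}+sj+k(m-j)}{m-1\brack j-1}_k. \]
   Context: Overpartitions here are non-increasing sequences of positive integers in which the last occurrence of each distinct part value may be overlined; a part $t$ or $\overline t$ has size $t$, written $|\cdot|=t$; $|\lambda|$ is the sum of part sizes and $\ell_o(\lambda)$ the number of overlined parts. An $L_k$-overpartition is an overpartition $\pi=(\pi_1,\ldots,\pi_\ell)$ such that whenever $\pi_i$ is overlined, $\ell-i\equiv 0\pmod k$. For $m\ge1$, $\mathcal{BL}_k(m)$ is the set of $L_k$-overpartitions $\lambda=(\lambda_1,\ldots,\lambda_m)$ with exactly $m$ parts such that $\lambda_m=\overline1$ or $1$, and for $1\le i<m$, $|\lambda_i|\le|\lambda_{i+1}|+1$, with strict inequality if $\lambda_i$ is non-overlined. For $m,j\ge1$, $\mathcal{BL}_k(m,j)$ (resp. $\mathcal{BL}_k(m,\overline j)$) is the set of overpartitions in $\mathcal{BL}_k(m)$ whose largest part is $j$ (resp. $\overline j$), and $GL_k(m,j)=\sum_{\lambda\in\mathcal{BL}_k(m,j)}z^{\ell_o(\lambda)}q^{|\lambda|}$, $GL_k(m,\overline j)=\sum_{\lambda\in\mathcal{BL}_k(m,\overline j)}z^{\ell_o(\lambda)}q^{|\lambda|}$. Also ${A\brack B}_k=\frac{(q^k;q^k)_A}{(q^k;q^k)_B(q^k;q^k)_{A-B}}$ for $A\ge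 B\ge0$ and $0$ otherwise, with $(a;q)_n=\prod_{i=0}^{n-1}(1-aq^i)$. *)

(* Defs.v *)
From HB Require Import structures.
From mathcomp Require Import all_boot all_order all_algebra.
From mathcomp Require Import boolp classical_sets functions cardinality fsbigop.

Set Implicit Arguments.
Unset Strict Implicit.
Unset Printing Implicit Defensive.

Import Order.TTheory GRing.Theory.

Local Open Scope classical_set_scope.

(* [(t, b)] is the part of size [t], overlined iff [b]. *)
Notation part := (nat * bool)%type.
Definition part0 : part := (0, false).
Definition psize (p : part) : nat := p.1.
Definition overlined (p : part) : bool := p.2.
Definition overline (t : nat) : part := (t, true).
Definition plain (t : nat) : part := (t, false).

(* Sequences are indexed from 0: the part written pi_i on paper is
   [nth part0 pi (i - 1)]. *)
Definition overpartition (pi : seq part) : Prop :=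
  [/\ all (fun p => 0 < psize p) pi,
      sorted geq (map psize pi)
    & forall i j, i < j -> j < size pi -> overlined (nth part0 pi i) ->
        psize (nth part0 pi j) <> psize (nth part0 pi i)].

Definition weight (pi : seq part) : nat := \sum_(p <- pi) psize p.
Definition num_overlined (pi : seq part) : nat := count overlined pi.

Definition L_overpartition (k : nat) (pi : seq part) : Prop :=
  overpartition pi /\
  forall i, i < size pi -> overlined (nth part0 pi i) ->
    size pi - i.+1 = 0 %[mod k].

Definition BL (k m : nat) : set (seq part) :=
  [set la | [/\ L_overpartition k la, size la = m,
      last part0 la = overline 1 \/ last part0 la = plain 1
    & forall i, i.+1 < m ->
        psize (nth part0 la i) <= psize (nth part0 la i.+1) + 1 /\
        (~~ overlined (nth part0 la i) ->
         psize (nth part0 la i) < psize (nth part0 la i.+1) + 1)]].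

(* Only the last occurrence of a value may be overlined, so the first part is
   the largest one, for the order in which the overlined [t] precedes the
   plain [t]. *)
Definition BL_largest (k m : nat) (p : part) : set (seq part) :=
  [set la | BL k m la /\ head part0 la = p].

(* Hence the finitely supported sum in [GL] is an actual sum over the set. *)
Lemma finite_BL_largest k m p : finite_set (BL_largest k m p).
Proof.
pose f (t : m.-tuple ('I_(psize p).+1 * bool)) : seq part :=
  [seq (nat_of_ord x.1, x.2) | x <- t].
apply: (@sub_finite_set _ _ (f @` setT)); last first.
  exact/finite_image/finite_finset.
move=> la [[[[_ srt _] _] sz _ _] hd].
have bnd : all (fun x => psize x < (psize p).+1) la.
  case: la srt hd {sz} => //= x la srt hd; rewrite hd ltnS leqnn /=.
  rewrite hd in srt.
  move/order_path_min: srt => /(_ (fun x y z h1 h2 => leq_trans h2 h1)).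
  by rewrite all_map; apply: sub_all => y /=; rewrite ltnS.
pose g (x : part) : 'I_(psize p).+1 * bool := (inord x.1, x.2).
have sg : size (map g la) == m by rewrite size_map sz.
exists (Tuple sg) => //=.
rewrite /f /= -map_comp -[RHS]map_id; apply/eq_in_map => -[t b] /(allP bnd) /= h.
by rewrite inordK.
Qed.

Local Open Scope ring_scope.

Definition GL (R : comNzRingType) (z q : R) (k m : nat) (p : part) : R :=
  \sum_(la \in BL_largest k m p) z ^+ num_overlined la * q ^+ weight la.

Definition qpoch (R : comNzRingType) (a q : R) (n : nat) : R :=
  \prod_(0 <= i < n) (1 - a * q ^+ i).

Definition qbinom (F : fieldType) (q : F) (k A B : nat) : F :=
  if (B <= A)%N then
    qpoch (q ^+ k) (q ^+ k) A
      / (qpoch (q ^+ k) (q ^+ k) B * qpoch (q ^+ k) (q ^+ k) (A - B))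
  else 0.

(* The identity is between rational functions of two indeterminates.  It is
   asserted for arbitrary elements [z], [q] of a field such that no
   denominator of [qbinom] vanishes, which includes the indeterminates
   themselves and complex [q] with |q| < 1. *)
Definition not_root_of_unity (F : fieldType) (q : F) : Prop :=
  forall n : nat, (0 < n)%N -> q ^+ n != 1.

(* Main.v *)
(* A sequence in BL_k(M) is determined by its overlined parts: read from the
   right, the size starts at 1 and increases by one exactly at each overlined
   part other than the last part, and only positions at distance divisible by k
   from the end may be overlined.  Removing the first part therefore gives a
   recursion on M for the generating function by size of the largest part.  It
   multiplies by [q ^+ j] when k does not divide the new distance, and is the
   q-Pascal rule in base q^k when it does. *)
Require Import Defs.
From HB Require Import structures.
From mathcomp Require Import all_boot all_order all_algebra.
From mathcomp Require Import boolp classical_sets functions cardinality fsbigop.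
From mathcomp Require Import ring zify.

Import Order.TTheory GRing.Theory.
Local Open Scope ring_scope.

(** Monotonicity and the step condition leave only the sizes t and t + 1 in front of a part of size
    t. The strict inequality excludes t + 1 for a plain first part; an overlined one excludes t,
    being the last occurrence of its size. *)
Lemma BL_cons (k n : nat) (p : part) (la : seq part) :
  BL k n.+2 (p :: la) <->
  BL k n.+1 la /\
  p.1 = ((head part0 la).1 + p.2)%N /\ (p.2 -> (k %| n.+1)%N).
Proof.
split.
  move=> [[[pos srt ov] hL] /= [sz] hlast hstep].
  case: la sz pos srt ov hL hlast hstep => [//|p' la] /= [sz] pos srt ov hL hlast hstep.
  have [/andP[p0 pos'] /andP[le_p srt']] := (pos, srt).
  split; last split.
  - split=> //=; last by move=> i hi; exact: (hstep i.+1).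
      split; last by move=> i hi; exact: (hL i.+1).
      by split=> // i l hi hl; exact: (ov i.+1 l.+1).
    by rewrite sz.
  - have /= [h1 h2] := hstep 0 isT.
    have /= h3 := ov 0 1 isT isT.
    rewrite /psize /overlined in h1 h2 h3 le_p.
    case: p.2 h2 h3 => h2 h3; rewrite /= in h2 h3 *; last first.
      by move: (h2 isT) le_p => /=; lia.
    by move: (h3 isT) le_p => /=; lia.
  - move=> p2; have /= := hL 0 isT p2.
    by rewrite subn1 /= sz mod0n => /eqP.
move=> [[[[pos srt ov] hL] sz hlast hstep] [p1 p2]].
case: la sz pos srt ov hL hlast hstep p1 => [//|p' la] sz pos srt ov hL hlast hstep /= p1.
have p'0 : (0 < p'.1)%N by case/andP: pos.
split=> //=; last 2 first.
- by move: sz => /= ->.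
- case=> [|i] hi /=; last exact: (hstep i).
  by rewrite /psize /overlined p1; split; case: p.2 => //=; lia.
split.
  split.
  - by rewrite /= in pos; rewrite /= pos andbT /psize p1; lia.
  - rewrite /= in srt; rewrite /= srt andbT /psize p1; lia.
  - case=> [|i] [|l] //= hil hl; last exact: (ov i l).
    rewrite /overlined /psize p1 => -> /=.
    (* The tail is non-increasing and an overlined new part is larger by one than its head, so its
       size does not recur. *)
    suff : (psize (nth part0 (p' :: la) l) <= p'.1)%N by rewrite /psize /=; lia.
    have /allP h : all (geq p'.1) (map psize (p' :: la)).
      rewrite /= leqnn /=; apply: order_path_min srt.
      by move=> a b c h1 h2; exact: leq_trans h2 h1.
    by apply: h; apply: map_f; exact: mem_nth.
case=> [|i] hi /=; last exact: (hL i).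
by move/p2; move: sz => /= [->]; rewrite subn1 /= mod0n => /eqP.
Qed.

(* The argument [n] is the number of parts minus one, and [i] the size of the
   largest part minus one. *)
Fixpoint BL_enum (k n i : nat) : seq (seq part) :=
  match n with
  | 0 => if i == 0 then [:: [:: plain 1]; [:: overline 1]] else [::]
  | n'.+1 =>
      map (cons (plain i.+1)) (BL_enum k n' i) ++
      (if i is i'.+1 then
         if (k %| n'.+1)%N then map (cons (overline i.+1)) (BL_enum k n' i')
         else [::]
       else [::])
  end.

Lemma BL_head_gt0 {k n : nat} {la : seq part} :
  BL k n.+1 la -> (0 < (head part0 la).1)%N.
Proof. by case: la => [|p la] [[[/= pos _ _] _] sz _ _] //; case/andP: pos. Qed.

Lemma mem_BL_enum (k n i : nat) (la : seq part) :
  la \in BL_enum k n i <-> BL k n.+1 la /\ psize (head part0 la) = i.+1.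
Proof.
elim: n i la => [|n IHn] i la /=.
  split.
    have hb b : BL k 1 [:: (1%N, b)].
      split=> //; last by case: b; [left | right].
      by split; first split=> //; case=> [|?] // [].
    by case: eqP => // ->; rewrite !inE => /orP[] /eqP ->; split=> //; exact: hb.
  move=> [[[_ _] sz hlast _]].
  case: la sz hlast => [|p [|]] //= _.
  by case=> -> [<-]; rewrite !inE eqxx ?orbT.
case: la => [|[t b] la].
  split; last by move=> [[]].
  rewrite mem_cat => /orP[/mapP[]//|].
  by case: i => [|i] //; case: ifP => // _ /mapP[].
rewrite BL_cons mem_cat /=; split.
  case/orP=> [/mapP[x /IHn[hx h] [-> -> ->]]|].
    by rewrite /= addn0.
  case: i => [|i] //; case: ifP => // hk /mapP[x /IHn[hx h] [-> -> ->]].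
  by rewrite /= addn1; rewrite /psize in h; rewrite h.
rewrite /psize /=; move=> [[hBL [ht hk]] ti]; subst t.
have h0 := BL_head_gt0 hBL.
rewrite ti; case: b hk ti => hk ht; last first.
  apply/orP; left; apply/mapP; exists la => //.
  by apply/IHn; split=> //; rewrite /psize; lia.
apply/orP; right; case: i ht => [|i] ht; first by rewrite /= in ht; lia.
rewrite hk //; apply/mapP; exists la => //.
by apply/IHn; split=> //; rewrite /psize; move: ht => /=; lia.
Qed.

Lemma uniq_BL_enum (k n i : nat) : uniq (BL_enum k n i).
Proof.
elim: n i => [|n IHn] i /=; first by case: eqP.
have inj p : injective (@cons part p) by move=> x y [].
rewrite cat_uniq map_inj_uniq // IHn /=.
case: i => [|i] //; case: ifP => // _.
rewrite map_inj_uniq // IHn andbT.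
by apply/hasPn => x /mapP[y _ ->]; apply/mapP => -[].
Qed.

Definition gf {R : comNzRingType} (z q : R) (s : seq (seq part)) : R :=
  \sum_(la <- s) z ^+ num_overlined la * q ^+ weight la.

Lemma gf_map_cons {R : comNzRingType} (z q : R) (p : part) s :
  gf z q (map (cons p) s) = z ^+ p.2 * q ^+ p.1 * gf z q s.
Proof.
rewrite /gf big_map big_distrr; apply: eq_bigr => la _ /=.
rewrite /weight big_cons /num_overlined /= !exprD /psize /overlined; ring.
Qed.

Lemma gf_cat {R : comNzRingType} (z q : R) s1 s2 :
  gf z q (s1 ++ s2) = gf z q s1 + gf z q s2.
Proof. exact: big_cat. Qed.

(** What may be prepended depends on the size of the head but not on its overlining, so the
    recursion closes on the sum of the two functions. *)
Lemma GL_sum {R : comNzRingType} (z q : R) (k n i : nat) :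
  GL z q k n.+1 (plain i.+1) + GL z q k n.+1 (overline i.+1) =
  gf z q (BL_enum k n i).
Proof.
rewrite /GL /gf -fsbigU0; try exact: finite_BL_largest.
  rewrite [RHS]fsbig_seq ?uniq_BL_enum //.
  suff : (BL_largest k n.+1 (plain i.+1) `|` BL_largest k n.+1 (overline i.+1)
    = [set` BL_enum k n i])%classic by move->.
  apply/seteqP; split=> la /= h.
    by apply/mem_BL_enum; case: h => -[hB ->].
  have [hB] := (mem_BL_enum _ _ _ _).1 h.
  case hp : (head part0 la) => [t []]; rewrite /psize /= => et; subst t;
  by [left | right].
by move=> la [[_ hd] [_]]; rewrite hd.
Qed.

Section QBinomial.
Variables (F : fieldType) (q : F) (k : nat).
Hypotheses (hq : not_root_of_unity q) (hk : (0 < k)%N).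

Lemma qpochS {R : comNzRingType} (a x : R) n :
  qpoch a x n.+1 = qpoch a x n * (1 - a * x ^+ n).
Proof. by rewrite /qpoch big_nat_recr. Qed.

Lemma qpoch_factor_neq0 n : 1 - q ^+ k * (q ^+ k) ^+ n != 0.
Proof.
rewrite -exprS -exprM subr_eq0 eq_sym; apply: hq.
by rewrite muln_gt0 hk.
Qed.

Lemma qpoch_neq0 n : qpoch (q ^+ k) (q ^+ k) n != 0.
Proof.
elim: n => [|n IHn]; first by rewrite /qpoch big_geq ?oner_eq0.
by rewrite qpochS mulf_neq0 ?qpoch_factor_neq0.
Qed.

Lemma qbinom0 n : qbinom q k n 0 = 1.
Proof.
by rewrite /qbinom subn0 {2}/qpoch big_geq // mul1r divff ?qpoch_neq0.
Qed.

(** For i < n, with Q = q^k and common factors cleared, this is 1 - Q^(n+1) = (1 - Q^(i+1)) +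
    Q^(i+1) (1 - Q^(n-i)). *)
Lemma qbinomS n i :
  qbinom q k n.+1 i.+1 = qbinom q k n i + q ^+ (k * i.+1) * qbinom q k n i.+1.
Proof.
rewrite /qbinom ltnS; case: (ltngtP i n) => [lt_in | // | ->]; last first.
- have h0 : qpoch (q ^+ k) (q ^+ k) 0 = 1 by rewrite /qpoch big_geq.
  by rewrite mulr0 addr0 !subnn h0 !mulr1 !divff ?qpoch_neq0.
- by rewrite mulr0 addr0.
(* Naming the gap removes the truncated subtractions and lets every power of Q split into Q^i and
   Q^d. *)
have [d ->] : exists d, n = (i + d).+1 by exists (n - i.+1)%N; lia.
have -> : ((i + d).+2 - i.+1 = d.+1)%N by lia.
have -> : ((i + d).+1 - i = d.+1)%N by lia.
have -> : ((i + d).+1 - i.+1 = d)%N by lia.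
have := qpoch_factor_neq0 d; have := qpoch_factor_neq0 i.
rewrite (qpochS _ _ (i + d).+1) (qpochS _ _ i) (qpochS _ _ d) exprM.
have := qpoch_neq0 i; have := qpoch_neq0 d.
rewrite -addnS exprD !exprS.
move: (qpoch _ _ i) (qpoch _ _ d) => a b.
move: (qpoch _ _ _) => c.
move: (q ^+ k) => Q; move: (Q ^+ i) (Q ^+ d) => x y *; field.
by apply/and4P; split.
Qed.

End QBinomial.

(* [s] and [i] stand for s - 1 and j - 1 of the theorem, so that the exponent
   involves no truncated subtraction. *)
Lemma gf_BL_enum (F : fieldType) (z q : F) (hq : not_root_of_unity q)
    (k s n i : nat) (hs : (s < k)%N) :
  gf z q (BL_enum k (k * n + s) i) =
  (z ^+ i + z ^+ i.+1)
    * q ^+ (k * 'C(i, 2) + s.+1 * i.+1 + k * n) * qbinom q k n i.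
Proof.
have hk : (0 < k)%N by exact: leq_ltn_trans hs.
(* Inside a block of k positions the new distance is not divisible by k, so only a plain copy of the
   head's size can be prepended. *)
have step n' s' i' : (s'.+1 < k)%N ->
  gf z q (BL_enum k (k * n' + s').+1 i') =
  q ^+ i'.+1 * gf z q (BL_enum k (k * n' + s') i').
  move=> hs'; rewrite /= gf_cat gf_map_cons /= expr0 mul1r.
  case: i' => [|i']; first by rewrite [X in _ + X]big_nil addr0.
  rewrite -addnS dvdn_addr ?dvdn_mulr // gtnNdvd //.
  by rewrite [X in _ + X]big_nil addr0.
elim: n s hs i => [|n IHn]; elim=> [|s IHs] hs i.
- rewrite muln0 /=; case: i => [|i] /=; last by rewrite /gf big_nil /qbinom mulr0.
  rewrite qbinom0 // muln0 /gf !big_cons big_nil /weight !big_cons !big_nil /=.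
  by rewrite !expr0 !expr1; ring.
- rewrite addnS step // IHs; last exact: ltnW.
  rewrite mulrA; congr (_ * _); rewrite mulrCA -exprD.
  by congr (_ * q ^+ _); nia.
(* A new block starts from the last position, k - 1, of the previous one; only here can the new part
   be overlined. *)
- have -> : (k * n.+1 + 0 = (k * n + k.-1).+1)%N by nia.
  have kM : (k %| (k * n + k.-1).+1)%N.
    by rewrite -addnS prednK // dvdn_addr ?dvdn_mulr.
  have lt_k : (k.-1 < k)%N by rewrite ltn_predL.
  rewrite /= kM gf_cat gf_map_cons /= expr0 mul1r IHn // prednK //.
  case: i => [|i].
    rewrite [X in _ + X]big_nil addr0 !qbinom0 // !mulr1 mulrCA -exprD.
    by congr (_ * q ^+ _); nia.
  rewrite gf_map_cons IHn // prednK // qbinomS // binS bin1 /=.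
  (* The overlined term carries exponent e and the plain one e + k(i+1), which is the weight in the
     q-Pascal rule. *)
  set e := (k * 'C(i, 2) + k * i + k * n.+1)%N.
  have -> : (k * ('C(i, 2) + i) + k * i.+2 + k * n = e + k * i.+1)%N.
    by rewrite /e; nia.
  have -> : (k * 'C(i, 2) + k * i.+1 + k * n = e)%N by rewrite /e; nia.
  have -> : (k * ('C(i, 2) + i) + 1 * i.+2 + k * n.+1 = e + i.+2)%N.
    by rewrite /e; nia.
  rewrite !exprD !(exprS z); ring.
- rewrite addnS step // IHs; last exact: ltnW.
  rewrite mulrA; congr (_ * _); rewrite mulrCA -exprD.
  by congr (_ * q ^+ _); nia.
Qed.

Theorem theorem3p4 (F : fieldType) (z q : F) (hq : not_root_of_unity q)
    (k s m j : nat) (hk : (1 <= k)%N) (hs1 : (1 <= s)%N) (hsk : (s <= k)%N)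
    (hj : (1 <= j)%N) (hjm : (j <= m)%N) :
  GL z q k (k * (m - 1) + s)%N (plain j)
    + GL z q k (k * (m - 1) + s)%N (overline j)
  = (z ^+ (j - 1)%N + z ^+ j) * q ^+ (k * 'C(j, 2) + s * j + k * (m - j))%N
      * qbinom q k (m - 1) (j - 1).
Proof.
case: s hs1 hsk => // s _ hsk; case: j hj hjm => // i _ hjm.
(* With j = i + 1, the exponents agree because C(j,2) = C(i,2) + i and ki + k(m-j) = k(m-1). *)
rewrite addnS GL_sum gf_BL_enum // !subn1 /= binS bin1.
by congr (_ * q ^+ _ * _); nia.
Qed.
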